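(* Let $n,k,t,s$ be positive integers with $1\le t<k$, $s\ge 1$ and $n\ge 4sk\binom{2k}{t+1}$. Let $\mathcal{F}\subseteq\binom{[n]}{k}$ satisfy $\nu_t(\mathcal{F})=s$. Then $|\mathcal{F}|\le \ell(n,k,t,s)$, and equality holds if $\mathcal{F}=\mathcal{S}(\mathcal{T})$ for some family $\mathcal{T}$ consisting of $s$ pairwise disjoint $t$-subsets of $[n]$.
   Context: $[n]=\{1,\dots,n\}$ and $\binom{[n]}{k}$ is the family of $k$-element subsets of $[n]$. A $t$-matching of size $m$ is a collection $\{A_1,\dots,A_m\}\subseteq\binom{[n]}{k}$ of distinct sets with $|A_i\cap A_j|<t$ for all $i\ne j$; the $t$-matching number $\nu_t(\mathcal{F})$ is the maximum size of a $t$-matching contained in $\mathcal{F}$. For $T\in\binom{[n]}{t}$, the $t$-star with center $T$ is $\mathcal{S}(T)=\{F\in\binom{[n]}{k}:T\subseteq F\}$, and for $\mathcal{T}=\{T_1,\dots,T_m\}\subseteq\binom{[n]}{t}$, $\mathcal{S}(\mathcal{T})=\bigcup_{i=1}^m\mathcal{S}(T_i)$. $\ell(n,k,t,m)$ denotes $|\mathcal{S}(\mathcal{T})|$ when $\mathcal{T}$ consists of $m$ distinct pairwise disjoint $t$-sets (this does not depend on the choice), and $\ell(n,k,t,0)=0$. *)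

(* Defs.v *)
From mathcomp Require Import all_boot.

Set Implicit Arguments.
Unset Strict Implicit.
Unset Printing Implicit Defensive.

(* The ground set [n] = {1, ..., n} is 'I_n = {0, ..., n-1}. *)
Definition ksubsets (n k : nat) : {set {set 'I_n}} :=
  [set A : {set 'I_n} | #|A| == k].

Definition t_matching (n k t : nat) (M : {set {set 'I_n}}) : bool :=
  (M \subset ksubsets n k) &&
  [forall A in M, forall B in M, (A != B) ==> (#|A :&: B| < t)].

Definition t_matching_number (n k t : nat) (F : {set {set 'I_n}}) : nat :=
  \max_(M : {set {set 'I_n}} | (M \subset F) && t_matching k t M) #|M|.

Definition t_star (n k : nat) (T : {set 'I_n}) : {set {set 'I_n}} :=
  [set F in ksubsets n k | T \subset F].

Definition t_stars (n k : nat) (TT : {set {set 'I_n}}) : {set {set 'I_n}} :=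
  \bigcup_(T in TT) t_star k T.

Definition disjoint_tsets (n t m : nat) (TT : {set {set 'I_n}}) : bool :=
  [&& TT \subset ksubsets n t, #|TT| == m & trivIset TT].

(* The cardinality is the same for every choice of the family.  The default 0
   is reached only when [n] contains no m distinct pairwise disjoint t-sets;
   for m = 0 the only family is set0, so that ell n k t 0 = 0. *)
Definition ell (n k t m : nat) : nat :=
  if [pick TT : {set {set 'I_n}} | disjoint_tsets t m TT] is Some TT
  then #|t_stars k TT| else 0.

(* Main.v *)
Require Import Defs.
From mathcomp Require Import all_boot zify.

(* Call a t-set heavy when more than s k C(n-t-1,k-t-1) members of F contain it.
   A t-matching none of whose members contains a given heavy T can be extended
   by some B in F containing T: as long as at most s other sets are involved,
   the B's meeting one of them outside T are too few.  Hence there are m <= s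
   heavy sets, and the subfamily F' of members containing no heavy set has
   t-matching number at most s - m.  Every member of F' shares a (non-heavy)
   t-set with a member of a maximum t-matching of F', so
   |F'| <= (s - m) C(k,t) s k C(n-t-1,k-t-1), while for n large this is at most
   ell(s) - ell(m).  The other members of F lie in the union of the m stars with
   heavy centers, of size at most ell(m): two centers that meet lose
   C(n-u,k-u) sets with u < 2t, which outweighs the at most m C(n-2t,k-2t) sets
   lost by a center disjoint from the m others. *)

Set Implicit Arguments.
Unset Strict Implicit.
Unset Printing Implicit Defensive.

(** * Subsets of prescribed size and a union bound *)

Lemma exists_subset_card (T : finType) (A : {set T}) (m : nat) :
  m <= #|A| -> exists2 B : {set T}, B \subset A & #|B| = m.
Proof.
move=> le_mA; have: 0 < #|[set B : {set T} | B \subset A & #|B| == m]|.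
  by rewrite cards_draws bin_gt0.
by case/card_gt0P=> B; rewrite inE => /andP[sBA /eqP cB]; exists B.
Qed.

Lemma leq_card_bigcup (I T : finType) (P : {set I}) (E : I -> {set T}) (b : nat) :
  (forall i, i \in P -> #|E i| <= b) -> #|\bigcup_(i in P) E i| <= #|P| * b.
Proof.
move=> leEb; rewrite -sum_nat_const.
apply: (@leq_trans (\sum_(i in P) #|E i|)); last exact: leq_sum.
elim/big_rec2: _ => [|i m B _ IH]; first by rewrite cards0.
by rewrite (leq_trans (leq_card_setU _ _)) // leq_add2l.
Qed.

(** * Exact sizes of stars and of unions of stars with disjoint centers *)

(* The guard matters when k < a, where truncated subtraction would give 'C(n - a, 0) = 1. *)
Definition star_card (n k a : nat) : nat :=
  if a <= k then 'C(n - a, k - a) else 0.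

(* The number of k-sets that contain a fixed a-set A and none of m t-sets, when
   these are disjoint from A and from each other: among those avoiding m - 1 of
   the t-sets, remove the ones containing the last. *)
Fixpoint avoid_card (n k t m a : nat) : nat :=
  if m is m'.+1 then avoid_card n k t m' a - avoid_card n k t m' (a + t)
  else star_card n k a.

(** Centers are added one at a time: term [i] is the contribution of a center disjoint from [i]
    earlier ones. *)
Definition stars_card (n k t m : nat) : nat := \sum_(i < m) avoid_card n k t i t.

Definition avoiding (n k : nat) (A : {set 'I_n}) (TT : {set {set 'I_n}}) :
    {set {set 'I_n}} :=
  [set F in t_star k A | [forall T in TT, ~~ (T \subset F)]].

(** When [#|A| <= k], the map from [D] to [A :|: D] is a bijection from the [(k - #|A|)]-subsets of
    the complement of [A] onto the star. *)
Lemma card_t_star (n k : nat) (A : {set 'I_n}) :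
  #|t_star k A| = star_card n k #|A|.
Proof.
rewrite /star_card; case: leqP => [le_Ak|lt_kA]; last first.
  apply: eq_card0 => F; rewrite !inE; apply/negP => /andP[/eqP cF /subset_leq_card].
  by rewrite cF leqNgt lt_kA.
have cC: #|~: A| = n - #|A| by have := cardsC A; rewrite card_ord; lia.
rewrite -cC -cards_draws -(card_in_imset (f := fun D => A :|: D)); last first.
  move=> D E; rewrite !inE => /andP[sD _] /andP[sE _] eqU.
  have AK (X : {set 'I_n}) : X \subset ~: A -> (A :|: X) :\: A = X.
    move=> sX; apply/setP=> x; rewrite !inE.
    case: (boolP (x \in X)) => [/(subsetP sX)|_]; rewrite ?inE ?orbT ?orbF ?andbT //.
    by rewrite andNb.
  by rewrite -(AK D sD) eqU AK.
apply: eq_card => F; rewrite !inE; apply/andP/imsetP => [[/eqP cF sAF]|[D]].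
  exists (F :\: A); last by rewrite setDE setUIr setUCr setIT (setUidPr sAF).
  by rewrite inE setDE subsetIr -setDE cardsD (setIidPr sAF) cF eqxx.
rewrite inE => /andP[sD /eqP cD] ->; split; last exact: subsetUl.
have: [disjoint A & D] by rewrite disjoint_sym disjoints_subset.
by rewrite -(leq_card_setU A D) => /eqP ->; rewrite cD subnKC.
Qed.

Lemma avoidingU1 (n k : nat) (A T : {set 'I_n}) (TT : {set {set 'I_n}}) :
  avoiding k A (T |: TT) = avoiding k A TT :\: avoiding k (A :|: T) TT.
Proof.
apply/setP=> F; rewrite !inE subUset.
have ->: [forall U in T |: TT, ~~ (U \subset F)]
       = ~~ (T \subset F) && [forall U in TT, ~~ (U \subset F)].
  apply/forall_inP/andP => [H|[nT /forall_inP H] U]; last first.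
    by rewrite !inE => /predU1P[->//|]; exact: H.
  split; first by apply: H; rewrite setU11.
  by apply/forall_inP=> U UTT; apply: H; rewrite setU1r.
by case: (#|F| == k); case: (A \subset F); case: (T \subset F); case: [forall _ in _, _].
Qed.

Lemma avoidingS (n k : nat) (A B : {set 'I_n}) (TT : {set {set 'I_n}}) :
  A \subset B -> avoiding k B TT \subset avoiding k A TT.
Proof.
move=> sAB; apply/subsetP=> F; rewrite !inE => /andP[/andP[-> sBF] ->].
by rewrite (subset_trans sAB).
Qed.

Lemma avoiding0 (n k : nat) (A : {set 'I_n}) : avoiding k A set0 = t_star k A.
Proof.
apply/setP=> F; rewrite !inE; apply: andb_idr => _.
by apply/forall_inP=> T; rewrite inE.
Qed.

Lemma disjoint_tsetsD1 (n t m : nat) (T : {set 'I_n}) (TT : {set {set 'I_n}}) :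
  disjoint_tsets t m.+1 TT -> T \in TT -> disjoint_tsets t m (TT :\ T).
Proof.
case/and3P=> sTT /eqP cTT triv TTT; apply/and3P; split.
- exact: subset_trans (subD1set _ _) sTT.
- by move: cTT; rewrite (cardsD1 T) TTT add1n => -[->].
- exact: trivIsetS (subD1set _ _) triv.
Qed.

(** Taking out one center [T] gives the recursion of [avoid_card]: [A :|: T] has [#|A| + t] elements
    and is still disjoint from the other centers. *)
Lemma card_avoiding (n k t m : nat) (A : {set 'I_n}) (TT : {set {set 'I_n}}) :
  disjoint_tsets t m TT -> (forall T, T \in TT -> [disjoint A & T]) ->
  #|avoiding k A TT| = avoid_card n k t m #|A|.
Proof.
elim: m A TT => [|m IH] A TT dTT dA.
  by case/and3P: dTT => _; rewrite cards_eq0 => /eqP -> _; rewrite avoiding0 card_t_star.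
have [T TTT]: exists T, T \in TT.
  by apply/card_gt0P; case/and3P: dTT => _ /eqP ->.
have dTT' := disjoint_tsetsD1 dTT TTT.
case/and3P: dTT => /subsetP sTT _ /trivIsetP triv.
rewrite -(setD1K TTT) avoidingU1 cardsD (setIidPr (avoidingS _ _ (subsetUl A T))).
rewrite /= (IH A) //; last by move=> U; rewrite !inE => /andP[_ /dA].
rewrite (IH (A :|: T)) //; last first.
  move=> U; rewrite !inE => /andP[neq UTT].
  by rewrite -setI_eq0 setIUl setU_eq0 !setI_eq0 dA //= triv // eq_sym.
have /eqP-> : #|A :|: T| == #|A| + #|T| by rewrite (leq_card_setU A T) dA.
by have := sTT _ TTT; rewrite inE => /eqP ->.
Qed.

Lemma card_t_starsU1 (n k : nat) (T : {set 'I_n}) (TT : {set {set 'I_n}}) :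
  #|t_stars k (T |: TT)| = #|t_stars k TT| + #|avoiding k T TT|.
Proof.
have ->: t_stars k (T |: TT) = t_stars k TT :|: avoiding k T TT.
  apply/setP=> F; rewrite !inE; apply/bigcupP/orP => [[U]|].
    rewrite !inE => UTT /andP[cF sUF].
    case: (boolP [forall U in TT, ~~ (U \subset F)]) => [H|].
      right; rewrite andbT cF; case/predU1P: UTT => [<-//|/(forall_inP H)].
      by rewrite sUF.
    case/forall_inPn=> V VTT; rewrite negbK => sVF; left.
    by apply/bigcupP; exists V; rewrite // !inE cF.
  case=> [/bigcupP[U UTT FU]|/andP[FT _]]; first by exists U; rewrite // setU1r.
  by exists T; rewrite ?setU11 // !inE.
apply/eqP; rewrite (leq_card_setU (t_stars k TT) _) disjoint_sym disjoints_subset.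
apply/subsetP=> F; rewrite !inE => /andP[_ /forall_inP H].
by apply/bigcupP=> -[U /H nUF]; rewrite !inE (negbTE nUF) andbF.
Qed.

Lemma card_t_stars_disjoint (n k t m : nat) (TT : {set {set 'I_n}}) :
  disjoint_tsets t m TT -> #|t_stars k TT| = stars_card n k t m.
Proof.
elim: m TT => [|m IH] TT dTT.
  case/and3P: dTT => _; rewrite cards_eq0 => /eqP -> _.
  by rewrite /t_stars /stars_card !big_set0 big_ord0 cards0.
have [T TTT]: exists T, T \in TT.
  by apply/card_gt0P; case/and3P: dTT => _ /eqP ->.
have dTT' := disjoint_tsetsD1 dTT TTT.
case/and3P: dTT => /subsetP sTT _ /trivIsetP triv.
rewrite -(setD1K TTT) card_t_starsU1 (IH _ dTT') /stars_card big_ord_recr /=.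
rewrite (card_avoiding _ dTT'); last first.
  by move=> U; rewrite !inE => /andP[neq UTT]; rewrite triv // eq_sym.
by have := sTT _ TTT; rewrite inE => /eqP ->.
Qed.

(** * Estimates for star sizes, and centers that meet *)

Lemma star_cardS (n k a : nat) :
  (n - a) * star_card n k a.+1 = (k - a) * star_card n k a.
Proof.
rewrite /star_card; case: (ltngtP a k) => [ltak|ltka|->].
- rewrite (_ : k - a = (k - a.+1).+1); last by lia.
  by rewrite -mul_bin_diag -subnS.
- by rewrite (_ : k - a = 0) ?muln0 //; lia.
- by rewrite subnn muln0.
Qed.

Lemma leq_star_card (n k a b : nat) :
  k <= n -> a <= b -> star_card n k b <= star_card n k a.
Proof.
move=> lekn; elim: b => [|b IH]; first by rewrite leqn0 => /eqP ->.
rewrite leq_eqVlt => /predU1P[->//|/IH]; apply: leq_trans.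
case: (ltnP b k) => [ltbk|lekb]; last by rewrite /star_card ltnNge lekb.
rewrite -(@leq_pmul2l (n - b)) ?subn_gt0 ?(leq_trans ltbk) // star_cardS.
by rewrite leq_mul2r leq_sub2r ?orbT.
Qed.

Lemma leq_avoid_card (n k t m a : nat) : avoid_card n k t m a <= star_card n k a.
Proof. by elim: m a => //= m IH a; apply: leq_trans (leq_subr _ _) (IH a). Qed.

(** Inclusion-exclusion cut after the first-order terms: each of the [m] avoided sets costs at most
    [star_card n k (a + t)]. *)
Lemma avoid_card_geq (n k t m a : nat) :
  star_card n k a <= avoid_card n k t m a + m * star_card n k (a + t).
Proof.
elim: m => [|m IH] /=; first by rewrite addn0.
have := leq_avoid_card n k t m (a + t); lia.
Qed.

(** By [star_cardS], sizes for centers of [a] and [a + 1] elements, [a < k], have ratio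
    [(n - a) / (k - a)], which is at least [m]. *)
Lemma leq_mul_star_card (n k a m : nat) :
  0 < a -> k + m * k <= n -> m * star_card n k a <= star_card n k a.-1.
Proof.
case: a => // a _ le_n /=; have := star_cardS n k a.
case: (ltnP a k) => [ltak|leka _]; last by rewrite /star_card ltnNge leka muln0.
move=> eqS; rewrite -(@leq_pmul2l (n - a)); last by lia.
rewrite mulnCA eqS mulnA leq_mul2r; apply/orP; right; nia.
Qed.

(** As [T] and [U] meet, their union has at most [2t - 1] elements. Avoiding [U] alone thus costs at
    least [star_card n k (2t - 1)], no less than the [m * star_card n k (2t)] that bounds the loss
    of a disjoint center. *)
Lemma leq_card_avoiding (n k t m : nat) (T U : {set 'I_n}) (TT : {set {set 'I_n}}) :
  #|T| = t -> #|U| = t -> U \in TT -> ~~ [disjoint T & U] -> k + m * k <= n ->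
  #|avoiding k T TT| <= avoid_card n k t m t.
Proof.
move=> cT cU UTT meetTU le_n.
have ltU: #|T :|: U| < t + t.
  have := cardsUI T U; rewrite cT cU => <-.
  by rewrite -setI_eq0 -card_gt0 in meetTU; lia.
have: #|avoiding k T TT| <= star_card n k t - star_card n k #|T :|: U|.
  rewrite -{1}cT -!card_t_star.
  have sS: t_star k (T :|: U) \subset t_star k T.
    by apply/subsetP=> B; rewrite !inE subUset => /and3P[-> ->].
  have := cardsD (t_star k T) (t_star k (T :|: U)); rewrite (setIidPr sS) => <-; apply: subset_leq_card.
  apply/subsetP=> B; rewrite !inE subUset => /andP[/andP[-> ->] /forall_inP /(_ _ UTT)].
  by move=> nUB; rewrite (negbTE nUB).
have := avoid_card_geq n k t m t.
have := @leq_mul_star_card n k (t + t) m _ le_n.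
have := @leq_star_card n k #|T :|: U| (t + t).-1 _ _.
lia.
Qed.

(** Induction on [m], removing a center that meets another one; if no two centers meet, the count is
    exact. *)
Lemma leq_card_t_stars (n k t m : nat) (TT : {set {set 'I_n}}) :
  TT \subset ksubsets n t -> #|TT| = m -> k + m * k <= n ->
  #|t_stars k TT| <= stars_card n k t m.
Proof.
elim: m TT => [|m IH] TT sTT cTT le_n.
  by rewrite (cards0_eq cTT) /t_stars big_set0 cards0.
have [triv|] := boolP (trivIset TT).
  by rewrite (@card_t_stars_disjoint n k t m.+1) //; apply/and3P; rewrite cTT.
have sT T : T \in TT -> #|T| = t.
  by move/(subsetP sTT); rewrite inE => /eqP.
have [/existsP[T /andP[TTT /existsP[U /and3P[UTT neq meet]]]] _|nex] :=
  boolP [exists T, (T \in TT) && [exists U, [&& U \in TT, T != U & ~~ [disjoint T & U]]]];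
  last first.
  case/trivIsetP => T U TTT UTT neq; apply: contraR nex => meet.
  by apply/existsP; exists T; rewrite TTT; apply/existsP; exists U; rewrite UTT neq.
rewrite -(setD1K TTT) card_t_starsU1 /stars_card big_ord_recr /= leq_add //.
  apply: IH; first exact: subset_trans (subD1set _ _) sTT.
    by move: cTT; rewrite (cardsD1 T) TTT add1n => -[->].
  by lia.
apply: (leq_card_avoiding (sT T TTT) (sT U UTT) _ meet); last by lia.
by rewrite !inE eq_sym neq.
Qed.

(** * Existence of disjoint t-sets and the value of [ell] *)

Lemma exists_disjoint_tsets (n t m : nat) :
  0 < t -> m * t <= n -> exists TT : {set {set 'I_n}}, disjoint_tsets t m TT.
Proof.
move=> t_gt0; elim: m => [|m IH] le_n.
  exists set0; apply/and3P; split; rewrite ?sub0set ?cards0 //.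
  by apply/trivIsetP=> A B; rewrite inE.
have [|TT /and3P[sTT /eqP cTT triv]] := IH; first by lia.
have cC: t <= #|~: cover TT|.
  have /eqP := (leq_card_cover TT).2; rewrite triv.
  have := leq_card_cover TT => -[].
  rewrite (eq_bigr (fun=> t)); last by move=> A /(subsetP sTT); rewrite inE => /eqP.
  rewrite sum_nat_const cTT => le_c _ _.
  by have := cardsC (cover TT); rewrite card_ord; lia.
have [T sT cT] := exists_subset_card cC.
have dT: {in TT, forall B : {set 'I_n}, [disjoint T & B]}.
  move=> B BTT; rewrite disjoints_subset; apply: subset_trans sT _.
  by rewrite setCS; apply: bigcup_sup.
(* [trivIsetU1] needs nonempty members, which [0 < t] provides. *)
have nz: set0 \notin TT.
  by apply/negP=> /(subsetP sTT); rewrite inE cards0 eq_sym; lia.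
have [triv' TnTT] := trivIsetU1 dT triv nz.
exists (T |: TT); apply/and3P; split=> //.
  by rewrite subUset sTT sub1set inE cT eqxx.
by rewrite cardsU1 TnTT cTT.
Qed.

Lemma ell_stars_card (n k t m : nat) :
  0 < t -> m * t <= n -> ell n k t m = stars_card n k t m.
Proof.
move=> t_gt0 le_n; rewrite /ell; case: pickP => [TT|no].
  exact: card_t_stars_disjoint.
by have [TT] := exists_disjoint_tsets t_gt0 le_n; rewrite no.
Qed.

(** * Matchings and degrees *)

Lemma t_matchingU1 (n k t : nat) (B : {set 'I_n}) (P : {set {set 'I_n}}) :
  t_matching k t P -> #|B| = k -> (forall A, A \in P -> #|B :&: A| < t) ->
  t_matching k t (B |: P).
Proof.
case/andP=> sP /forall_inP mP cB BP; apply/andP; split.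
  by rewrite subUset sP sub1set inE cB eqxx.
apply/forall_inP=> A; rewrite !inE => AP; apply/forall_inP=> A'; rewrite !inE => AP'.
case/predU1P: AP => [->|AP]; case/predU1P: AP' => [->|AP']; rewrite ?eqxx //.
- by rewrite BP // implybT.
- by rewrite setIC BP // implybT.
by move/forall_inP: (mP _ AP) => ->.
Qed.

Lemma t_matchingS (n k t : nat) (P Q : {set {set 'I_n}}) :
  P \subset Q -> t_matching k t Q -> t_matching k t P.
Proof.
move=> sPQ /andP[sQ /forall_inP mQ]; rewrite /t_matching (subset_trans sPQ sQ) /=.
apply/forall_inP=> A /(subsetP sPQ) AQ; apply/forall_inP=> B /(subsetP sPQ).
by move/forall_inP: (mQ _ AQ); exact.
Qed.

Lemma leq_t_matching_number (n k t : nat) (F M : {set {set 'I_n}}) :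
  M \subset F -> t_matching k t M -> #|M| <= t_matching_number k t F.
Proof.
move=> sMF mM.
by apply: (@leq_bigmax_cond _ _ (fun M : {set {set 'I_n}} => #|M|)); rewrite sMF.
Qed.

Lemma exists_t_matching (n k t : nat) (F : {set {set 'I_n}}) :
  exists M : {set {set 'I_n}},
    [/\ M \subset F, t_matching k t M & #|M| = t_matching_number k t F].
Proof.
have H: 0 < #|[pred M : {set {set 'I_n}} | (M \subset F) && t_matching k t M]|.
  apply/card_gt0P; exists set0; rewrite inE sub0set /t_matching sub0set /=.
  by apply/forall_inP=> A; rewrite inE.
have [M /andP[sMF mM] eqM] := eq_bigmax_cond (fun M : {set {set 'I_n}} => #|M|) H.
by exists M; split=> //; rewrite -eqM; apply: eq_bigl.
Qed.

Definition degree (n : nat) (F : {set {set 'I_n}}) (T : {set 'I_n}) : nat :=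
  #|[set B in F | T \subset B]|.

(** Let [M] be a maximum t-matching. By maximality each member of [F] shares a t-set with some
    member of [M], and [M] offers at most [#|M| * 'C(k, t)] such t-sets. *)
Lemma card_leq_degree (n k t b : nat) (F : {set {set 'I_n}}) :
  F \subset ksubsets n k -> t <= k ->
  (forall T : {set 'I_n}, #|T| = t -> degree F T <= b) ->
  #|F| <= t_matching_number k t F * ('C(k, t) * b).
Proof.
move=> sF le_tk leb; have [M [sMF mM eqM]] := exists_t_matching k t F.
pose E (A : {set 'I_n}) : {set {set 'I_n}} :=
  \bigcup_(T in [set T : {set 'I_n} | T \subset A & #|T| == t])
    [set B in F | T \subset B].
apply: (@leq_trans #|\bigcup_(A in M) E A|); last first.
  rewrite -eqM; apply: leq_card_bigcup => A /(subsetP sMF) /(subsetP sF); rewrite inE => /eqP <-.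
  rewrite -cards_draws; apply: leq_card_bigcup => T; rewrite inE => /andP[_ /eqP].
  exact: leb.
apply: subset_leq_card; apply/subsetP=> B BF.
have cB: #|B| = k by have := subsetP sF B BF; rewrite inE => /eqP.
suff [A AM le_t]: exists2 A, A \in M & t <= #|B :&: A|.
  have [T sT cT] := exists_subset_card le_t.
  apply/bigcupP; exists A => //; apply/bigcupP; exists T.
    by rewrite inE cT eqxx (subset_trans sT) ?subsetIr.
  by rewrite inE BF (subset_trans sT) ?subsetIl.
apply/exists_inP; apply: contraT => /exists_inPn noA.
have BM: B \notin M by apply/negP=> /noA; rewrite setIid cB le_tk.
have: #|B |: M| <= t_matching_number k t F.
  apply: leq_t_matching_number; first by rewrite subUset sub1set BF.
  by apply: t_matchingU1 => // A /noA; rewrite -ltnNge.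
by rewrite cardsU1 BM eqM add1n ltnn.
Qed.

(** * Extending a matching through heavy sets *)

Lemma card_hitting (n k : nat) (T X : {set 'I_n}) :
  [disjoint X & T] ->
  #|[set B in t_star k T | ~~ [disjoint B & X]]| <= #|X| * star_card n k #|T|.+1.
Proof.
move=> dXT; apply: (@leq_trans #|\bigcup_(x in X) t_star k (x |: T)|); last first.
  apply: leq_card_bigcup => x xX; rewrite card_t_star cardsU1.
  by rewrite (disjointFr dXT xX).
apply: subset_leq_card; apply/subsetP=> B; rewrite !inE => /andP[/andP[cB sTB]].
case/pred0Pn=> x /andP[/= xB xX]; apply/bigcupP; exists x => //.
by rewrite !inE cB subUset sub1set xB.
Qed.

(** Induction on [#|HH|]: a heavy [T] is traded for some [B] in [F] containing it, and [B] joins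
    [P]. The bound [s.+1] keeps the other sets at most [s] in number. *)
Lemma heavy_extension (n k t s : nat) (F P HH : {set {set 'I_n}}) :
  F \subset ksubsets n k -> t <= k -> P \subset F -> t_matching k t P ->
  (forall T, T \in HH -> #|T| = t /\ s * k * star_card n k t.+1 < degree F T) ->
  (forall T A, T \in HH -> A \in P -> ~~ (T \subset A)) ->
  #|P| + #|HH| <= s.+1 ->
  #|P| + #|HH| <= t_matching_number k t F.
Proof.
move=> sF le_tk; move cHH: #|HH| => m.
elim: m HH P cHH => [|m IH] HH P cHH sPF mP heavy nsub le_s.
  by rewrite addn0; apply: leq_t_matching_number.
have [T THH]: exists T, T \in HH by apply/card_gt0P; rewrite cHH.
have [cT degT] := heavy T THH.
have cHH': #|HH :\ T| = m by move: cHH; rewrite (cardsD1 T) THH add1n => -[].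
(* The points that [B] must avoid: those of all other sets, outside [T]. *)
pose X := (cover P :|: cover (HH :\ T)) :\: T.
have dXT: [disjoint X & T].
  by rewrite disjoints_subset; apply/subsetP=> x; rewrite !inE => /andP[].
have cX: #|X| <= s * k.
  apply: leq_trans (subset_leq_card (subsetDl _ _)) _.
  apply: leq_trans (leq_card_setU _ _) _.
  have: #|cover P| <= #|P| * k.
    apply: leq_card_bigcup => A /(subsetP sPF) /(subsetP sF).
    by rewrite inE => /eqP ->.
  have: #|cover (HH :\ T)| <= #|HH :\ T| * k.
    by apply: leq_card_bigcup => U; rewrite !inE => /andP[_ /heavy[-> _]].
  rewrite cHH'; nia.
(* Otherwise all members through [T] hit [X], and [card_hitting] contradicts heaviness. *)
have [B BF /andP[sTB dBX]]: exists2 B, B \in F & (T \subset B) && [disjoint B & X].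
  apply/exists_inP; apply: contraT => /exists_inPn noB.
  have := leq_ltn_trans (leq_mul cX (leqnn _)) degT.
  rewrite -cT ltnNge => /negP[]; apply: leq_trans (card_hitting k dXT).
  apply: subset_leq_card; apply/subsetP=> B; rewrite inE => /andP[BF sTB].
  have := noB B BF; rewrite sTB /= => nd.
  by rewrite !inE sTB nd; have := subsetP sF B BF; rewrite inE => ->.
have cB: #|B| = k by have := subsetP sF B BF; rewrite inE => /eqP.
have BXT (A : {set 'I_n}) : A \subset cover P :|: cover (HH :\ T) -> B :&: A \subset T.
  move=> sA; apply/subsetP=> x; rewrite inE => /andP[xB xA].
  apply: contraT => xT; have := disjointFr dBX xB.
  by rewrite !inE xT; have := subsetP sA x xA; rewrite inE => ->.
have BnP: B \notin P by apply/negP=> /(nsub _ _ THH); rewrite sTB.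
have := IH (HH :\ T) (B |: P) cHH'; rewrite cardsU1 BnP add1n addSnnS.
apply.
- by rewrite subUset sub1set BF.
- apply: t_matchingU1 => // A AP; rewrite -cT; apply: proper_card.
  rewrite properE BXT /=; last by apply: subset_trans (subsetUl _ _); apply: bigcup_sup.
  by apply: contra (nsub _ _ THH AP) => sTBA; apply: subset_trans sTBA (subsetIr _ _).
- by move=> U; rewrite !inE => /andP[_ /heavy].
(* If [U] were inside [B], then [U] would lie in [T], hence equal [T] by size. *)
- move=> U A; rewrite !inE => /andP[neq UHH] /predU1P[->|]; last exact: nsub.
  apply: (contra _ neq) => sUB.
  rewrite eqEcard cT (heavy U UHH).1 leqnn andbT.
  rewrite -(setIidPr sUB); apply: BXT; apply: subset_trans (subsetUr _ _).
  by apply: bigcup_sup; rewrite !inE neq.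
- by [].
Qed.

(** * Numerical estimates *)

Lemma leq_ffact_double (k m : nat) : 2 ^ m * k ^_ m <= (2 * k) ^_ m.
Proof.
elim: m => [|m IH]; first by rewrite !ffactn0.
rewrite expnS !ffactnSr.
have le2: 2 * (k - m) <= 2 * k - m by lia.
by apply: leq_trans (leq_mul IH le2); rewrite [2 * 2 ^ m]mulnC mulnACA.
Qed.

(** The left side is [t.+1 * 'C(k, t.+1)]; doubling [k] gains a factor of at least [2 ^ t.+1], which
    exceeds [t.+1]. *)
Lemma leq_bin_double (k t : nat) : (k - t) * 'C(k, t) <= 'C(2 * k, t.+1).
Proof.
rewrite -mul_bin_left -(@leq_pmul2r t.+1`!) ?fact_gt0 // -mulnA !bin_ffact.
apply: leq_trans (leq_ffact_double _ _); rewrite leq_mul2r.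
by apply/orP; right; apply: ltnW; apply: ltn_expl.
Qed.

Lemma stars_card_geq (n k t m s g : nat) :
  m <= s -> (forall i, i < s -> g <= avoid_card n k t i t) ->
  stars_card n k t m + (s - m) * g <= stars_card n k t s.
Proof.
elim: s => [|s IH]; first by rewrite leqn0 => /eqP -> _; rewrite addn0.
rewrite leq_eqVlt => /predU1P[-> _|lems geg]; first by rewrite subnn addn0.
rewrite /stars_card big_ord_recr /= subSn // mulSn addnCA addnC leq_add ?geg //.
by apply: IH => // i ltis; apply: geg; apply: ltnW.
Qed.

Theorem theorem1p2 (n k t s : nat)
    (n_gt0 : 0 < n) (k_gt0 : 0 < k) (t_gt0 : 1 <= t) (t_lt_k : t < k)
    (s_gt0 : 1 <= s) (n_large : 4 * s * k * 'C(2 * k, t.+1) <= n)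
    (F : {set {set 'I_n}}) (F_uniform : F \subset ksubsets n k)
    (nuF : t_matching_number k t F = s) :
  #|F| <= ell n k t s /\
  ((exists TT : {set {set 'I_n}},
      disjoint_tsets t s TT /\ F = t_stars k TT) ->
   #|F| = ell n k t s).
Proof.
have le_tk := ltnW t_lt_k.
(* Chosen so that [(n - t) * g = Q * star_card n k t] for the [g] below. *)
pose Q := 'C(k, t) * s * k * (k - t).
have le4Q: 4 * Q <= n.
  apply: leq_trans n_large.
  rewrite (_ : 4 * Q = 4 * s * k * ((k - t) * 'C(k, t))); last by rewrite /Q; lia.
  by rewrite leq_mul2l leq_bin_double orbT.
have bin_k_gt0: 0 < 'C(k, t) by rewrite bin_gt0.
have le_skQ: s * k <= Q.
  rewrite (_ : Q = s * k * ('C(k, t) * (k - t))); last by rewrite /Q; lia.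
  by rewrite leq_pmulr // muln_gt0 bin_k_gt0 subn_gt0.
have le_kQ: k <= Q by apply: leq_trans le_skQ; rewrite leq_pmull.
have le_stQ: s * t <= Q by apply: leq_trans le_skQ; rewrite leq_mul2l le_tk orbT.
have le_skn: k + s * k <= n by lia.
have le_stn: s * t <= n by lia.
rewrite (ell_stars_card _ t_gt0 le_stn); split; last first.
  by case=> TT [dTT ->]; apply: card_t_stars_disjoint.
pose b := s * k * star_card n k t.+1.
pose g := 'C(k, t) * b.
have le_g i : i < s -> g <= avoid_card n k t i t.
  move=> ltis; have := avoid_card_geq n k t i t.
  have: i * star_card n k (t + t) <= s * star_card n k t.+1.
    by apply: leq_mul; [exact: ltnW | apply: leq_star_card; lia].
  (* Multiplied by [n - t], this reduces through [star_cardS] to [Q + s * (k - t) <= n - t], which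
     follows from [4 * Q <= n]. *)
  suff: g + s * star_card n k t.+1 <= star_card n k t by lia.
  rewrite -(@leq_pmul2l (n - t)); last by lia.
  have ->: (n - t) * (g + s * star_card n k t.+1)
         = ('C(k, t) * (s * k) + s) * ((n - t) * star_card n k t.+1).
    by rewrite /g /b; lia.
  rewrite star_cardS mulnA leq_mul2r; apply/orP; right.
  rewrite mulnDl !mulnA -/Q; have: s * (k - t) <= s * k by rewrite leq_mul2l leq_subr orbT.
  lia.
pose H := [set T : {set 'I_n} | #|T| == t & b < degree F T].
have extend (P HH : {set {set 'I_n}}) :
    P \subset F -> t_matching k t P -> HH \subset H ->
    (forall T A, T \in HH -> A \in P -> ~~ (T \subset A)) ->
    #|P| + #|HH| <= s.+1 -> #|P| + #|HH| <= s.
  move=> sPF mP sHH nsub le_s; rewrite -[X in _ <= X]nuF.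
  apply: (heavy_extension F_uniform le_tk sPF mP _ nsub le_s) => T.
  by move/(subsetP sHH); rewrite inE => /andP[/eqP].
have le_Hs: #|H| <= s.
  (* With more than [s] heavy sets, [s.+1] of them and an empty [P] would contradict [extend]. *)
  rewrite leqNgt; apply/negP => /exists_subset_card[HH sHH cHH].
  have := extend set0 HH (sub0set _) _ sHH; rewrite cards0 cHH ltnn => bad; suff: false by []; apply: bad => //.
    by rewrite /t_matching sub0set; apply/forall_inP=> A; rewrite inE.
  by move=> T A _; rewrite inE.
pose F' := [set B in F | [forall T in H, ~~ (T \subset B)]].
have sF'F: F' \subset F by apply/subsetP=> B; rewrite inE => /andP[].
have nuF': t_matching_number k t F' <= s - #|H|.
  have [M [sM mM <-]] := exists_t_matching k t F'.
  (* Here [s - #|H| + 1] members of a matching in [F'], together with [H], would make [s.+1]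
     sets. *)
  rewrite leqNgt; apply/negP => /exists_subset_card[P sPM cP].
  have := extend P H (subset_trans sPM (subset_trans sM sF'F)) (t_matchingS sPM mM).
  rewrite cP addSn subnK // ltnn => bad; suff: false by []; apply: bad => //.
  move=> T A TH /(subsetP sPM) /(subsetP sM); rewrite inE => /andP[_ /forall_inP].
  exact.
have cF': #|F'| <= (s - #|H|) * g.
  apply: leq_trans (leq_mul nuF' (leqnn g)).
  apply: card_leq_degree => // [|T cT]; first exact: subset_trans sF'F F_uniform.
  have [lt_b|le_b] := ltnP b (degree F T); last first.
    apply: leq_trans le_b; apply: subset_leq_card; apply/subsetP=> B.
    by rewrite !inE => /andP[/andP[-> _] ->].
  (* A heavy [T] lies in no member of [F'], so its degree there is 0. *)
  rewrite /degree (_ : [set _ in _ | _] = set0) ?cards0 //.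
  apply/setP=> B; rewrite !inE; apply/negP=> /andP[/andP[_ /forall_inP noH] sTB].
  by have := noH T; rewrite inE cT eqxx lt_b sTB => /(_ isT).
have cSH: #|t_stars k H| <= stars_card n k t #|H|.
  apply: leq_card_t_stars => //; last by nia.
  by apply/subsetP=> T; rewrite !inE => /andP[].
apply: leq_trans (stars_card_geq le_Hs le_g).
apply: leq_trans (leq_add cSH cF'); apply: leq_trans (leq_card_setU _ _).
apply: subset_leq_card; apply/subsetP=> B BF; rewrite in_setU.
have := subsetP F_uniform B BF; rewrite inE => cB.
apply/orP; case: (boolP [forall T in H, ~~ (T \subset B)]) => [nH|].
  by right; rewrite inE BF.
case/forall_inPn=> T TH; rewrite negbK => sTB.
by left; apply/bigcupP; exists T; rewrite // !inE cB.
Qed.
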